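(* Let $\mathcal C$ be a braided closed monoidal category that is (ExtrEpi, Mono)-structured. Let $A$ be an $\Omega$-magma in $\mathcal C$ and let $i\colon V\to[A,A]$ be a submonoid. Suppose that the forgetful functor $\mathbf{Hopf}(\mathcal C)\to\mathbf{Bimon}(\mathcal C)$ admits a right adjoint functor $H_r\colon\mathbf{Bimon}(\mathcal C)\to\mathbf{Hopf}(\mathcal C)$ and that the $V$-universal acting bimonoid ${}_\square\mathcal B(A,V)$ exists. Then there exists an initial object in $\mathbf{HAct}_V(A)^{\mathrm{op}}$ (i.e. the $V$-universal acting Hopf monoid ${}_\square\mathcal H(A,V)$ exists), where $\mathbf{HAct}_V(A)$ is the category of actions $\psi\colon H\otimes A\to A$ of arbitrary Hopf monoids $H$ such that $K\psi\colon H\to[A,A]$ factors through $i$.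
   Context: Associativity and unit constraints are suppressed; $c$ is the braiding and $\mathbf 1$ the monoidal unit; $\mathbf{Bimon}(\mathcal C)$ and $\mathbf{Hopf}(\mathcal C)$ are the categories of bimonoids and Hopf monoids in $\mathcal C$. $\Omega$ is a fixed set with maps $s,t\colon\Omega\to\mathbb Z_{\geq 0}$. An $\Omega$-magma in $\mathcal C$ is an object $A$ with morphisms $\omega_A\colon A^{\otimes s(\omega)}\to A^{\otimes t(\omega)}$ for all $\omega\in\Omega$ ($A^{\otimes 0}=\mathbf 1$; no identities are required). For a comonoid $(P,\Delta,\varepsilon)$ and $\psi_i\colon P\otimes A_i\to B_i$, put $\psi_1\tilde\otimes\psi_2=(\psi_1\otimes\psi_2)(\mathrm{id}_P\otimes c_{P,A_1}\otimes \mathrm{id}_{A_2})(\Delta\otimes \mathrm{id}_{A_1\otimes A_2})$; $\psi^{\tilde\otimes n}$ is the iterated product, $\psi^{\tilde\otimes 0}$ is $P\otimes\mathbf 1\cong P\xrightarrow{\varepsilon}\mathbf 1$. A measuring from $A$ to $B$ is a morphism $\psi\colon P\otimes A\to B$, $P$ a comonoid, with $\omega_B\,\psi^{\tilde\otimes s(\omega)}=\psi^{\tilde\otimes t(\omega)}(\mathrm{id}_P\otimes\omega_A)$ for all $\omega\in\Omega$. For a bimonoid $P$, an action of $P$ on $A$ is a measuring $P\otimes A\to A$ that is a left $P$-module structure. Closed means that each $(-)\otimes A$ has a right adjoint $[A,-]$ with counit $\mathrm{ev}_{A,B}\colon[A,B]\otimes A\to B$. For $\psi\colon P\otimes A\to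 B$, $K\psi\colon P\to[A,B]$ is the morphism with $\mathrm{ev}_{A,B}(K\psi\otimes \mathrm{id}_A)=\psi$. $[A,A]$ is a monoid in the unique way making $\mathrm{ev}_{A,A}$ a left module structure on $A$. A submonoid $i\colon V\to[A,A]$ is a monoid homomorphism that is a monomorphism in $\mathcal C$. (ExtrEpi, Mono)-structured: every morphism factors as an extremal epimorphism followed by a monomorphism, and the unique diagonalization property holds for these two classes. The $V$-universal acting bimonoid ${}_\square\mathcal B(A,V)$ is the bimonoid of the terminal object in the category of actions $\psi\colon B\otimes A\to A$ ($B$ any bimonoid) such that $K\psi$ factors through $i$, morphisms $\psi_1\to\psi_2$ being bimonoid homomorphisms $\varphi\colon B_1\to B_2$ with $\psi_2(\varphi\otimes \mathrm{id}_A)=\psi_1$. Morphisms of $\mathbf{HAct}_V(A)$ are defined in the same way with Hopf monoid homomorphisms. *)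

(* Defs.v *)
From Corelib Require Import ssreflect.
From Stdlib Require Import ProofIrrelevance.

Set Implicit Arguments.
Unset Strict Implicit.
Unset Printing Implicit Defensive.

Declare Scope cat_scope.
Delimit Scope cat_scope with cat.
Local Open Scope cat_scope.

Reserved Notation "g ∘ f" (at level 40, left associativity).
Reserved Notation "A ⊗ B" (at level 35, right associativity).
Reserved Notation "f ⊗m g" (at level 35, right associativity).

Record Category := MkCategory {
  ob :> Type;
  hom : ob -> ob -> Type;
  idm : forall A, hom A A;
  comp : forall A B D, hom B D -> hom A B -> hom A D;
  comp1m : forall A B (f : hom A B), comp (idm B) f = f;
  compm1 : forall A B (f : hom A B), comp f (idm A) = f;
  compA : forall A B D E (h : hom D E) (g : hom B D) (f : hom A B),
    comp (comp h g) f = comp h (comp g f)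
}.
Arguments hom {c} A B.
Arguments idm {c} A.
Arguments comp {c A B D} g f.
Notation "g ∘ f" := (comp g f) : cat_scope.

Definition op (C : Category) : Category :=
  @MkCategory C (fun A B => @hom C B A) (fun A => idm A)
    (fun A B D g f => f ∘ g)
    (fun A B f => compm1 f) (fun A B f => comp1m f)
    (fun A B D E h g f => eq_sym (compA f g h)).

Definition is_initial (C : Category) (X : C) : Prop :=
  forall Y : C, exists! f : hom X Y, True.
Definition is_terminal (C : Category) (X : C) : Prop :=
  forall Y : C, exists! f : hom Y X, True.

Definition is_iso (C : Category) (A B : C) (f : hom A B) : Prop :=
  exists g : hom B A, g ∘ f = idm A /\ f ∘ g = idm B.
Definition is_mono (C : Category) (A B : C) (f : hom A B) : Prop :=
  forall (X : C) (g h : hom X A), f ∘ g = f ∘ h -> g = h.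
Definition is_epi (C : Category) (A B : C) (f : hom A B) : Prop :=
  forall (X : C) (g h : hom B X), g ∘ f = h ∘ f -> g = h.
Definition is_extremal_epi (C : Category) (A B : C) (f : hom A B) : Prop :=
  is_epi f /\
  forall (X : C) (g : hom A X) (m : hom X B),
    is_mono m -> f = m ∘ g -> is_iso m.

Definition ExtrEpi_Mono_structured (C : Category) : Prop :=
  (forall (A B : C) (f : hom A B),
     exists (X : C) (e : hom A X) (m : hom X B),
       is_extremal_epi e /\ is_mono m /\ f = m ∘ e)
  /\
  (forall (A B X Y : C) (e : hom A B) (m : hom X Y)
          (f : hom A X) (g : hom B Y),
     is_extremal_epi e -> is_mono m -> g ∘ e = m ∘ f ->
     exists! d : hom B X, d ∘ e = f /\ m ∘ d = g).

Definition factors_through (C : Category) (X V Y : C)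
    (i : hom V Y) (f : hom X Y) : Prop :=
  exists g : hom X V, i ∘ g = f.

Record Functor (C D : Category) := MkFunctor {
  fob :> C -> D;
  fmap : forall A B : C, hom A B -> hom (fob A) (fob B);
  fmap1 : forall A : C, fmap (idm A) = idm (fob A);
  fmapM : forall (A B E : C) (g : hom B E) (f : hom A B),
    fmap (g ∘ f) = fmap g ∘ fmap f
}.
Arguments fmap {C D} f0 {A B} f.

(** [Adjunction F G] : [F] is left adjoint to [G]. *)
Record Adjunction (C D : Category) (F : Functor C D) (G : Functor D C) :=
  MkAdjunction {
  transpose : forall (X : C) (Y : D), hom (F X) Y -> hom X (G Y);
  untranspose : forall (X : C) (Y : D), hom X (G Y) -> hom (F X) Y;
  transposeK : forall X Y (f : hom (F X) Y), untranspose (transpose f) = f;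
  untransposeK : forall X Y (g : hom X (G Y)), transpose (untranspose g) = g;
  transpose_nat : forall (X X' : C) (Y Y' : D)
      (g : hom Y Y') (f : hom (F X) Y) (h : hom X' X),
    transpose (g ∘ f ∘ fmap F h) = fmap G g ∘ transpose f ∘ h
}.

Definition counit (C D : Category) (F : Functor C D) (G : Functor D C)
    (adj : Adjunction F G) (Y : D) : hom (F (G Y)) Y :=
  untranspose adj (idm (G Y)).

Lemma counit_transpose (C D : Category) (F : Functor C D) (G : Functor D C)
    (adj : Adjunction F G) (X : C) (Y : D) (f : hom (F X) Y) :
  counit adj Y ∘ fmap F (transpose adj f) = f.
Proof.
rewrite -[LHS](transposeK adj) -[LHS in transpose _ LHS]comp1m -compA.
by rewrite transpose_nat fmap1 comp1m /counit untransposeK comp1m transposeK.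
Qed.

Definition full_category (C : Category) (T : Type) (F : T -> C) : Category :=
  @MkCategory T (fun X Y => hom (F X) (F Y)) (fun X => idm (F X))
    (fun X Y Z g f => g ∘ f)
    (fun X Y f => comp1m f) (fun X Y f => compm1 f)
    (fun X Y Z W h g f => compA h g f).

Section ConcreteCategory.
Variables (C : Category) (T : Type) (F : T -> C).
Variable Q : forall X Y : T, hom (F X) (F Y) -> Prop.
Hypothesis Q1 : forall X : T, @Q X X (idm (F X)).
Hypothesis QM : forall (X Y Z : T) (g : hom (F Y) (F Z)) (f : hom (F X) (F Y)),
  @Q Y Z g -> @Q X Y f -> @Q X Z (g ∘ f).

Definition chom (X Y : T) : Type := {f : hom (F X) (F Y) | @Q X Y f}.

Lemma chom_ext (X Y : T) (f g : chom X Y) :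
  proj1_sig f = proj1_sig g -> f = g.
Proof.
case: f g => [f p] [g q] /= E; subst g.
by rewrite (proof_irrelevance _ p q).
Qed.

Definition chom_id (X : T) : chom X X := exist _ (idm (F X)) (Q1 X).
Definition chom_comp (X Y Z : T) (g : chom Y Z) (f : chom X Y) : chom X Z :=
  exist _ (proj1_sig g ∘ proj1_sig f) (QM (proj2_sig g) (proj2_sig f)).

Lemma chom_comp1m (X Y : T) (f : chom X Y) : chom_comp (chom_id Y) f = f.
Proof. apply: chom_ext; exact: comp1m. Qed.
Lemma chom_compm1 (X Y : T) (f : chom X Y) : chom_comp f (chom_id X) = f.
Proof. apply: chom_ext; exact: compm1. Qed.
Lemma chom_compA (X Y Z W : T) (h : chom Z W) (g : chom Y Z) (f : chom X Y) :
  chom_comp (chom_comp h g) f = chom_comp h (chom_comp g f).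
Proof. apply: chom_ext; exact: compA. Qed.

Definition concrete_category : Category :=
  MkCategory chom_comp1m chom_compm1 chom_compA.

End ConcreteCategory.
Arguments concrete_category {C T} F Q Q1 QM.

Record MonoidalCategory := MkMonoidal {
  mcat :> Category;
  tens : mcat -> mcat -> mcat;
  tensm : forall A A' B B' : mcat,
    hom A A' -> hom B B' -> hom (tens A B) (tens A' B');
  I1 : mcat;
  asc : forall A B D : mcat, hom (tens (tens A B) D) (tens A (tens B D));
  asc' : forall A B D : mcat, hom (tens A (tens B D)) (tens (tens A B) D);
  lun : forall A : mcat, hom (tens I1 A) A;
  lun' : forall A : mcat, hom A (tens I1 A);
  run : forall A : mcat, hom (tens A I1) A;
  run' : forall A : mcat, hom A (tens A I1);
  tensm1 : forall A B : mcat, tensm (idm A) (idm B) = idm (tens A B);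
  tensmM : forall (A1 A2 A3 B1 B2 B3 : mcat)
      (g : hom A2 A3) (f : hom A1 A2) (k : hom B2 B3) (h : hom B1 B2),
    tensm (g ∘ f) (k ∘ h) = tensm g k ∘ tensm f h;
  ascK : forall A B D, asc' A B D ∘ asc A B D = idm _;
  asc'K : forall A B D, asc A B D ∘ asc' A B D = idm _;
  lunK : forall A, lun' A ∘ lun A = idm _;
  lun'K : forall A, lun A ∘ lun' A = idm _;
  runK : forall A, run' A ∘ run A = idm _;
  run'K : forall A, run A ∘ run' A = idm _;
  asc_nat : forall (A A' B B' D D' : mcat)
      (f : hom A A') (g : hom B B') (h : hom D D'),
    asc A' B' D' ∘ tensm (tensm f g) h = tensm f (tensm g h) ∘ asc A B D;
  lun_nat : forall (A A' : mcat) (f : hom A A'),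
    lun A' ∘ tensm (idm I1) f = f ∘ lun A;
  run_nat : forall (A A' : mcat) (f : hom A A'),
    run A' ∘ tensm f (idm I1) = f ∘ run A;
  pentagon : forall A B D E : mcat,
    asc A B (tens D E) ∘ asc (tens A B) D E =
    tensm (idm A) (asc B D E) ∘ asc A (tens B D) E
      ∘ tensm (asc A B D) (idm E);
  triangle : forall A B : mcat,
    tensm (idm A) (lun B) ∘ asc A I1 B = tensm (run A) (idm B)
}.
Arguments tens {m} A B.
Arguments tensm {m A A' B B'} f g.
Arguments I1 {m}.
Arguments asc {m} A B D.
Arguments asc' {m} A B D.
Arguments lun {m} A.
Arguments lun' {m} A.
Arguments run {m} A.
Arguments run' {m} A.
Notation "A ⊗ B" := (tens A B) : cat_scope.
Notation "f ⊗m g" := (tensm f g) : cat_scope.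

Record BraidedCategory := MkBraided {
  bmon :> MonoidalCategory;
  braid : forall A B : bmon, hom (A ⊗ B) (B ⊗ A);
  braid_iso : forall A B : bmon, is_iso (braid A B);
  braid_nat : forall (A A' B B' : bmon) (f : hom A A') (g : hom B B'),
    braid A' B' ∘ (f ⊗m g) = (g ⊗m f) ∘ braid A B;
  hexagon1 : forall A B D : bmon,
    asc B D A ∘ braid A (B ⊗ D) ∘ asc A B D =
    (idm B ⊗m braid A D) ∘ asc B A D ∘ (braid A B ⊗m idm D);
  hexagon2 : forall A B D : bmon,
    asc' D A B ∘ braid (A ⊗ B) D ∘ asc' A B D =
    (braid A D ⊗m idm B) ∘ asc' A D B ∘ (idm A ⊗m braid B D)
}.
Arguments braid {b} A B.

Lemma tens_right_comp (C : MonoidalCategory) (A X Y Z : C)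
    (g : hom Y Z) (f : hom X Y) :
  (g ∘ f) ⊗m idm A = (g ⊗m idm A) ∘ (f ⊗m idm A).
Proof. by rewrite -tensmM comp1m. Qed.

Lemma tens_left_comp (C : MonoidalCategory) (A X Y Z : C)
    (g : hom Y Z) (f : hom X Y) :
  idm A ⊗m (g ∘ f) = (idm A ⊗m g) ∘ (idm A ⊗m f).
Proof. by rewrite -tensmM comp1m. Qed.

Definition tens_right (C : MonoidalCategory) (A : C) : Functor C C :=
  @MkFunctor C C (fun X => X ⊗ A) (fun X Y f => f ⊗m idm A)
    (fun X => tensm1 X A) (fun X Y Z g f => tens_right_comp A g f).

Record ClosedStructure (C : MonoidalCategory) := MkClosed {
  ihom_functor : C -> Functor C C;
  ihom_adj : forall A : C, Adjunction (tens_right A) (ihom_functor A)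
}.

Section Closed.
Variables (C : MonoidalCategory) (cl : ClosedStructure C).

Definition ihom (A B : C) : C := ihom_functor cl A B.

Definition ev (A B : C) : hom (ihom A B ⊗ A) B := counit (ihom_adj cl A) B.

Definition K (P A B : C) (psi : hom (P ⊗ A) B) : hom P (ihom A B) :=
  @transpose C C (tens_right A) _ (ihom_adj cl A) P B psi.

Lemma ev_K (P A B : C) (psi : hom (P ⊗ A) B) :
  ev A B ∘ (K psi ⊗m idm A) = psi.
Proof. exact: (@counit_transpose C C (tens_right A)). Qed.

Lemma ihom_ext (P A B : C) (f g : hom P (ihom A B)) :
  ev A B ∘ (f ⊗m idm A) = ev A B ∘ (g ⊗m idm A) -> f = g.
Proof.
pose adj := ihom_adj cl A.
have H (h : hom P (ihom A B)) : h = transpose adj (ev A B ∘ (h ⊗m idm A)).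
  rewrite -[ev A B]comp1m (@transpose_nat _ _ _ _ adj) fmap1 comp1m.
  by rewrite /ev /counit untransposeK comp1m.
by move=> E; rewrite (H f) (H g) E.
Qed.

End Closed.

Record MonoidStr (C : MonoidalCategory) (M : C) := MkMonoidStr {
  mu : hom (M ⊗ M) M;
  eta : hom I1 M;
  muA : mu ∘ (mu ⊗m idm M) = mu ∘ (idm M ⊗m mu) ∘ asc M M M;
  mu1m : mu ∘ (eta ⊗m idm M) = lun M;
  mum1 : mu ∘ (idm M ⊗m eta) = run M
}.

Record Monoid (C : MonoidalCategory) := MkMonoid {
  mon_ob :> C;
  mon_str :> MonoidStr mon_ob
}.

Definition is_monoid_hom (C : MonoidalCategory) (M N : C)
    (m : MonoidStr M) (n : MonoidStr N) (f : hom M N) : Prop :=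
  f ∘ mu m = mu n ∘ (f ⊗m f) /\ f ∘ eta m = eta n.

Record Submonoid (C : MonoidalCategory) (M : Monoid C) := MkSubmonoid {
  sub_mon :> Monoid C;
  sub_incl : hom sub_mon M;
  sub_incl_hom : is_monoid_hom sub_mon M sub_incl;
  sub_incl_mono : is_mono sub_incl
}.

Record ComonoidStr (C : MonoidalCategory) (P : C) := MkComonoidStr {
  delta : hom P (P ⊗ P);
  eps : hom P I1;
  deltaA : asc P P P ∘ (delta ⊗m idm P) ∘ delta = (idm P ⊗m delta) ∘ delta;
  eps_l : lun P ∘ (eps ⊗m idm P) ∘ delta = idm P;
  eps_r : run P ∘ (idm P ⊗m eps) ∘ delta = idm P
}.

Definition is_comonoid_hom (C : MonoidalCategory) (P Q : C)
    (p : ComonoidStr P) (q : ComonoidStr Q) (f : hom P Q) : Prop :=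
  delta q ∘ f = (f ⊗m f) ∘ delta p /\ eps q ∘ f = eps p.

(** The morphism written [id ⊗ c ⊗ id] when associativity is suppressed. *)
Definition mid_braid (C : BraidedCategory) (W X Y Z : C) :
    hom ((W ⊗ X) ⊗ (Y ⊗ Z)) ((W ⊗ Y) ⊗ (X ⊗ Z)) :=
  asc' W Y (X ⊗ Z)
    ∘ (idm W ⊗m (asc Y X Z ∘ (braid X Y ⊗m idm Z) ∘ asc' X Y Z))
    ∘ asc W X (Y ⊗ Z).

Record Bimonoid (C : BraidedCategory) := MkBimonoid {
  bim_ob :> C;
  bim_mon : MonoidStr bim_ob;
  bim_com : ComonoidStr bim_ob;
  bim_delta_mu :
    delta bim_com ∘ mu bim_mon =
    (mu bim_mon ⊗m mu bim_mon) ∘ mid_braid bim_ob bim_ob bim_ob bim_ob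
      ∘ (delta bim_com ⊗m delta bim_com);
  bim_delta_eta :
    delta bim_com ∘ eta bim_mon = (eta bim_mon ⊗m eta bim_mon) ∘ lun' I1;
  bim_eps_mu :
    eps bim_com ∘ mu bim_mon = lun I1 ∘ (eps bim_com ⊗m eps bim_com);
  bim_eps_eta : eps bim_com ∘ eta bim_mon = idm I1
}.

Definition is_bimonoid_hom (C : BraidedCategory) (B1 B2 : Bimonoid C)
    (f : hom B1 B2) : Prop :=
  is_monoid_hom (bim_mon B1) (bim_mon B2) f /\
  is_comonoid_hom (bim_com B1) (bim_com B2) f.

Record HopfMonoid (C : BraidedCategory) := MkHopfMonoid {
  hopf_bim :> Bimonoid C;
  antipode : hom hopf_bim hopf_bim;
  antipode_l :
    mu (bim_mon hopf_bim) ∘ (antipode ⊗m idm hopf_bim)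
      ∘ delta (bim_com hopf_bim) =
    eta (bim_mon hopf_bim) ∘ eps (bim_com hopf_bim);
  antipode_r :
    mu (bim_mon hopf_bim) ∘ (idm hopf_bim ⊗m antipode)
      ∘ delta (bim_com hopf_bim) =
    eta (bim_mon hopf_bim) ∘ eps (bim_com hopf_bim)
}.

Lemma is_bimonoid_hom_id (C : BraidedCategory) (B : Bimonoid C) :
  is_bimonoid_hom (B1 := B) (B2 := B) (idm B).
Proof. by do !split; rewrite ?tensm1 !(comp1m, compm1). Qed.

Lemma is_bimonoid_hom_comp (C : BraidedCategory) (B1 B2 B3 : Bimonoid C)
    (g : hom B2 B3) (f : hom B1 B2) :
  is_bimonoid_hom g -> is_bimonoid_hom f -> is_bimonoid_hom (g ∘ f).
Proof.
move=> [[gm g1] [gd ge]] [[fm f1] [fd fe]]; do !split.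
- by rewrite compA fm -compA gm compA -tensmM.
- by rewrite compA f1.
- by rewrite -compA gd compA fd -compA -tensmM.
- by rewrite -compA ge.
Qed.

Definition Bimon (C : BraidedCategory) : Category :=
  concrete_category (@bim_ob C) (@is_bimonoid_hom C)
    (@is_bimonoid_hom_id C) (@is_bimonoid_hom_comp C).

(** Bimonoid homomorphisms between Hopf monoids automatically commute with the
    antipodes, so Hopf monoids form a full subcategory of bimonoids. *)
Definition Hopf (C : BraidedCategory) : Category :=
  full_category (@hopf_bim C : HopfMonoid C -> Bimon C).

Definition forget_antipode (C : BraidedCategory) :
    Functor (Hopf C) (Bimon C) :=
  @MkFunctor (Hopf C) (Bimon C) (fun H => hopf_bim H) (fun H1 H2 f => f)
    (fun H => eq_refl) (fun H1 H2 H3 g f => eq_refl).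

Definition is_left_module (C : MonoidalCategory) (P A : C) (m : MonoidStr P)
    (psi : hom (P ⊗ A) A) : Prop :=
  psi ∘ (mu m ⊗m idm A) = psi ∘ (idm P ⊗m psi) ∘ asc P P A /\
  psi ∘ (eta m ⊗m idm A) = lun A.

Section UnitCoherence.
Variable C : MonoidalCategory.

Lemma tens_I1_faithful (X Y : C) (f g : hom X Y) :
  idm I1 ⊗m f = idm I1 ⊗m g -> f = g.
Proof.
move=> E.
have H (h : hom X Y) : h = lun Y ∘ (idm I1 ⊗m h) ∘ lun' X.
  by rewrite lun_nat compA lun'K compm1.
by rewrite (H f) (H g) E.
Qed.

(** Kelly's redundancy of one of Mac Lane's unit axioms. *)
Lemma lun_asc (A B : C) : lun (A ⊗ B) ∘ asc I1 A B = lun A ⊗m idm B.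
Proof.
apply: tens_I1_faithful.
have cancel (f g : hom (I1 ⊗ ((I1 ⊗ A) ⊗ B)) (I1 ⊗ (A ⊗ B))) :
    f ∘ asc I1 (I1 ⊗ A) B ∘ (asc I1 I1 A ⊗m idm B) =
    g ∘ asc I1 (I1 ⊗ A) B ∘ (asc I1 I1 A ⊗m idm B) -> f = g.
  move=> E.
  have H (h : hom (I1 ⊗ ((I1 ⊗ A) ⊗ B)) (I1 ⊗ (A ⊗ B))) :
      h = h ∘ asc I1 (I1 ⊗ A) B ∘ (asc I1 I1 A ⊗m idm B)
            ∘ (asc' I1 I1 A ⊗m idm B) ∘ asc' I1 (I1 ⊗ A) B.
    rewrite !compA -(compA (asc _ _ _ ⊗m _)) -tens_right_comp asc'K tensm1.
    by rewrite comp1m asc'K compm1.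
  by rewrite (H f) (H g) E.
apply: cancel.
rewrite tens_left_comp !compA -(compA (idm _ ⊗m asc _ _ _)) -pentagon.
rewrite -compA triangle -tensm1 -asc_nat.
rewrite -[RHS]compA -asc_nat compA.
by rewrite -tens_right_comp triangle.
Qed.

End UnitCoherence.

Section EndMonoid.
Variables (C : MonoidalCategory) (cl : ClosedStructure C) (A : C).

Let E := ihom cl A A.
Let e : hom (E ⊗ A) A := ev cl A A.

Definition end_mu : hom (E ⊗ E) E := K cl (e ∘ (idm E ⊗m e) ∘ asc E E A).
Definition end_eta : hom I1 E := K cl (lun A).

Lemma end_muA :
  end_mu ∘ (end_mu ⊗m idm E) = end_mu ∘ (idm E ⊗m end_mu) ∘ asc E E E.
Proof.
apply: (ihom_ext (cl := cl)); rewrite !tens_right_comp -!compA ev_K.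
rewrite -/e !compA asc_nat tensm1 -(compA (idm E ⊗m e)) -tensmM.
rewrite comp1m compm1.
have -> : end_mu ⊗m e = (end_mu ⊗m idm A) ∘ (idm (E ⊗ E) ⊗m e).
  by rewrite -tensmM comp1m compm1.
rewrite -!compA ev_K -/e !compA -tensm1 -(compA (asc _ _ _)) asc_nat.
rewrite !compA pentagon -!compA; congr (_ ∘ _).
rewrite [RHS]compA asc_nat -[RHS]compA; congr (_ ∘ _).
rewrite !compA; congr (_ ∘ _).
by rewrite -!tens_left_comp ev_K -/e !compA.
Qed.

Lemma end_mu1m : end_mu ∘ (end_eta ⊗m idm E) = lun E.
Proof.
apply: (ihom_ext (cl := cl)); rewrite !tens_right_comp -!compA ev_K.
rewrite -/e !compA asc_nat tensm1 -(compA (idm E ⊗m e)) -tensmM.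
rewrite comp1m compm1.
have -> : end_eta ⊗m e = (end_eta ⊗m idm A) ∘ (idm I1 ⊗m e).
  by rewrite -tensmM comp1m compm1.
by rewrite -!compA ev_K lun_nat compA lun_asc.
Qed.

Lemma end_mum1 : end_mu ∘ (idm E ⊗m end_eta) = run E.
Proof.
apply: (ihom_ext (cl := cl)); rewrite !tens_right_comp -!compA ev_K.
rewrite -/e !compA asc_nat -(compA (idm E ⊗m e)) -tensmM.
by rewrite comp1m ev_K triangle.
Qed.

Definition end_monoid : Monoid C :=
  MkMonoid (MkMonoidStr end_muA end_mu1m end_mum1).

Lemma ev_module : is_left_module end_monoid e.
Proof. by split; rewrite /= ev_K. Qed.

Lemma end_monoid_unique (m : MonoidStr E) :
  is_left_module m e -> mu m = end_mu /\ eta m = end_eta.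
Proof.
by case=> Hm H1; split; apply: (ihom_ext (cl := cl)); rewrite ev_K.
Qed.

End EndMonoid.

(** With the constraints suppressed, [tpow A 1 = A ⊗ I1] is [A]. *)
Fixpoint tpow (C : MonoidalCategory) (A : C) (n : nat) : C :=
  match n with
  | 0 => I1
  | S n' => A ⊗ tpow A n'
  end.

Record OmegaMagma (C : MonoidalCategory) (Omega : Type) (s t : Omega -> nat) :=
  MkOmegaMagma {
  om_ob :> C;
  om_op : forall w : Omega, hom (tpow om_ob (s w)) (tpow om_ob (t w))
}.

Definition ttens (C : BraidedCategory) (P A1 A2 B1 B2 : C) (p : ComonoidStr P)
    (psi1 : hom (P ⊗ A1) B1) (psi2 : hom (P ⊗ A2) B2) :
    hom (P ⊗ (A1 ⊗ A2)) (B1 ⊗ B2) :=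
  (psi1 ⊗m psi2) ∘ mid_braid P P A1 A2 ∘ (delta p ⊗m idm (A1 ⊗ A2)).

Fixpoint ttens_pow (C : BraidedCategory) (P A B : C) (p : ComonoidStr P)
    (psi : hom (P ⊗ A) B) (n : nat) : hom (P ⊗ tpow A n) (tpow B n) :=
  match n with
  | 0 => eps p ∘ run P
  | S n' => ttens p psi (ttens_pow p psi n')
  end.

Definition is_measuring (C : BraidedCategory) (Omega : Type)
    (s t : Omega -> nat) (A B : OmegaMagma C s t) (P : C) (p : ComonoidStr P)
    (psi : hom (P ⊗ A) B) : Prop :=
  forall w : Omega,
    om_op B w ∘ ttens_pow p psi (s w) =
    ttens_pow p psi (t w) ∘ (idm P ⊗m om_op A w).

Definition is_action (C : BraidedCategory) (Omega : Type)
    (s t : Omega -> nat) (A : OmegaMagma C s t) (B : Bimonoid C)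
    (psi : hom (B ⊗ A) A) : Prop :=
  is_measuring (bim_com B) psi /\ is_left_module (bim_mon B) psi.

Section ActionCategories.
Variables (C : BraidedCategory) (cl : ClosedStructure C).
Variables (Omega : Type) (s t : Omega -> nat) (A : OmegaMagma C s t).
Variable V : Submonoid (end_monoid cl A).

Record VAction := MkVAction {
  act_bim : Bimonoid C;
  act_map : hom (act_bim ⊗ A) A;
  act_action : is_action act_map;
  act_factors : factors_through (sub_incl V) (K cl act_map)
}.

Record VHopfAction := MkVHopfAction {
  hact_hopf : HopfMonoid C;
  hact_map : hom (hact_hopf ⊗ A) A;
  hact_action : is_action hact_map;
  hact_factors : factors_through (sub_incl V) (K cl hact_map)
}.

Definition intertwines (B1 B2 : Bimonoid C) (psi1 : hom (B1 ⊗ A) A)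
    (psi2 : hom (B2 ⊗ A) A) (phi : @hom (Bimon C) B1 B2) : Prop :=
  psi2 ∘ (proj1_sig phi ⊗m idm A) = psi1.

Lemma intertwines_id (B : Bimonoid C) (psi : hom (B ⊗ A) A) :
  intertwines psi psi (@idm (Bimon C) B).
Proof. by rewrite /intertwines /= tensm1 compm1. Qed.

Lemma intertwines_comp (B1 B2 B3 : Bimonoid C) (psi1 : hom (B1 ⊗ A) A)
    (psi2 : hom (B2 ⊗ A) A) (psi3 : hom (B3 ⊗ A) A)
    (g : @hom (Bimon C) B2 B3) (f : @hom (Bimon C) B1 B2) :
  intertwines psi2 psi3 g -> intertwines psi1 psi2 f ->
  intertwines psi1 psi3 (g ∘ f).
Proof.
by rewrite /intertwines /= => Hg Hf; rewrite tens_right_comp -compA Hg.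
Qed.

Definition Act : Category :=
  concrete_category (act_bim : VAction -> Bimon C)
    (fun X Y phi => intertwines (act_map X) (act_map Y) phi)
    (fun X => intertwines_id (act_map X))
    (fun X Y Z g f => @intertwines_comp _ _ _ _ _ _ g f).

Definition HAct : Category :=
  concrete_category (hact_hopf : VHopfAction -> Hopf C)
    (fun X Y phi => intertwines (hact_map X) (hact_map Y) phi)
    (fun X => intertwines_id (hact_map X))
    (fun X Y Z g f => @intertwines_comp _ _ _ _ _ _ g f).

(** [X] is a terminal [V]-action; its bimonoid [act_bim X] is then the
    [V]-universal acting bimonoid. *)
Definition universal_acting_bimonoid_exists : Prop :=
  exists X : Act, is_terminal X.

End ActionCategories.

(* Main.v *)
From Corelib Require Import ssreflect.
Require Import Defs.

Set Implicit Arguments.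
Unset Strict Implicit.
Unset Printing Implicit Defensive.

Local Open Scope cat_scope.

(** Let [psi : B ⊗ A -> A] be the terminal [V]-action and let [e : Hr B -> B]
    be the counit of the adjunction at [B].  Restricting [psi] along [e] gives
    the universal action of a Hopf monoid.  It is again a [V]-action: [e] is a
    comonoid homomorphism, so the twisted powers defining measurings restrict
    along it ([ttens_pow_restrict]); [e] is a monoid homomorphism, so modules
    restrict along it; and [K] sends restriction to precomposition
    ([K_restrict]), so the factorization through [V] persists.

    For a [V]-action [chi] of a Hopf monoid [H], a bimonoid homomorphism
    [f : H -> Hr B] carries [chi] to the restricted action exactly when
    [e ∘ f] carries [chi] to [psi].  Terminality of [psi] provides exactly one
    morphism [H -> B] of the latter kind, and by the adjunction
    [f |-> e ∘ f] is a bijection from morphisms [H -> Hr B] to morphisms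
    [H -> B] ([counit_transpose], [transpose_counit]). *)

Lemma transpose_counit (C D : Category) (F : Functor C D) (G : Functor D C)
    (adj : Adjunction F G) (X : C) (Y : D) (g : hom X (G Y)) :
  transpose adj (counit adj Y ∘ fmap F g) = g.
Proof.
rewrite -[counit adj Y]comp1m transpose_nat fmap1 comp1m.
by rewrite /counit untransposeK comp1m.
Qed.

Section Naturality.
Variable C : BraidedCategory.

(** The inverse associator inherits naturality from the associator by
    cancelling associators on both sides. *)
Lemma asc'_nat (A A' B B' D D' : C)
    (f : hom A A') (g : hom B B') (h : hom D D') :
  asc' A' B' D' ∘ (f ⊗m (g ⊗m h)) = ((f ⊗m g) ⊗m h) ∘ asc' A B D.
Proof.
rewrite -[LHS]compm1 -(asc'K A B D) -compA (compA (asc' _ _ _)) -asc_nat.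
by rewrite -(compA (asc' _ _ _)) ascK comp1m.
Qed.

Lemma mid_braid_nat (W W' X X' Y Y' Z Z' : C) (f : hom W W') (g : hom X X')
    (h : hom Y Y') (k : hom Z Z') :
  mid_braid W' X' Y' Z' ∘ ((f ⊗m g) ⊗m (h ⊗m k)) =
  ((f ⊗m h) ⊗m (g ⊗m k)) ∘ mid_braid W X Y Z.
Proof.
rewrite /mid_braid.
(* The braiding, conjugated by associators, acts on the last three factors. *)
have N : (asc Y' X' Z' ∘ (braid X' Y' ⊗m idm Z') ∘ asc' X' Y' Z')
           ∘ (g ⊗m (h ⊗m k)) =
         (h ⊗m (g ⊗m k))
           ∘ (asc Y X Z ∘ (braid X Y ⊗m idm Z) ∘ asc' X Y Z).
  rewrite compA asc'_nat -compA (compA (asc _ _ _)) -tensmM braid_nat comp1m.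
  by rewrite -[k in _ ⊗m k]compm1 tensmM -compA asc_nat !compA.
rewrite compA asc_nat -compA (compA (asc' _ _ _)) -tensmM N comp1m.
by rewrite -[f in f ⊗m _]compm1 tensmM -compA asc'_nat !compA.
Qed.

End Naturality.

Section Restriction.
Variable C : BraidedCategory.

(** The twisted product duplicates [P] by [delta], and a comonoid homomorphism
    [f] commutes with duplication; the two copies of [f] then slide through the
    braiding into the two factors. *)
Lemma ttens_restrict (P Q A1 A2 B1 B2 : C) (p : ComonoidStr P)
    (q : ComonoidStr Q) (f : hom P Q)
    (psi1 : hom (Q ⊗ A1) B1) (psi2 : hom (Q ⊗ A2) B2) :
  is_comonoid_hom p q f ->
  ttens p (psi1 ∘ (f ⊗m idm A1)) (psi2 ∘ (f ⊗m idm A2)) =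
  ttens q psi1 psi2 ∘ (f ⊗m idm (A1 ⊗ A2)).
Proof.
case=> fd _; rewrite /ttens tensmM.
rewrite [RHS]compA -tens_right_comp fd tens_right_comp -tensm1 -[RHS]compA.
by rewrite (compA (psi1 ⊗m psi2) _ ((f ⊗m f) ⊗m _)) mid_braid_nat !compA.
Qed.

Lemma ttens_pow_restrict (P Q A B : C) (p : ComonoidStr P)
    (q : ComonoidStr Q) (f : hom P Q) (psi : hom (Q ⊗ A) B) (n : nat) :
  is_comonoid_hom p q f ->
  ttens_pow p (psi ∘ (f ⊗m idm A)) n =
  ttens_pow q psi n ∘ (f ⊗m idm (tpow A n)).
Proof.
move=> hf; elim: n => [|n IH] /=; last by rewrite IH; exact: ttens_restrict.
by case: hf => _ fe; rewrite compA run_nat -compA fe.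
Qed.

Lemma is_measuring_restrict (Omega : Type) (s t : Omega -> nat)
    (A B : OmegaMagma C s t) (P Q : C) (p : ComonoidStr P) (q : ComonoidStr Q)
    (f : hom P Q) (psi : hom (Q ⊗ A) B) :
  is_comonoid_hom p q f -> is_measuring q psi ->
  is_measuring p (psi ∘ (f ⊗m idm A)).
Proof.
move=> hf hpsi w; rewrite !(ttens_pow_restrict _ _ hf) -compA hpsi !compA.
by rewrite -!tensmM !comp1m !compm1.
Qed.

Lemma is_left_module_restrict (M N A : C) (m : MonoidStr M) (n : MonoidStr N)
    (f : hom M N) (psi : hom (N ⊗ A) A) :
  is_monoid_hom m n f -> is_left_module n psi ->
  is_left_module m (psi ∘ (f ⊗m idm A)).
Proof.
case=> fm f1 [psim psi1]; split; last by rewrite compA -tens_right_comp f1.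
rewrite compA -tens_right_comp fm tens_right_comp -compA psim.
rewrite (compA _ (asc _ _ _)) asc_nat -compA; congr (_ ∘ _).
rewrite !compA; congr (_ ∘ _).
by rewrite -!tensmM !comp1m compm1.
Qed.

Lemma is_action_restrict (Omega : Type) (s t : Omega -> nat)
    (A : OmegaMagma C s t) (B1 B2 : Bimonoid C) (f : hom B1 B2)
    (psi : hom (B2 ⊗ A) A) :
  is_bimonoid_hom f -> is_action psi -> is_action (psi ∘ (f ⊗m idm A)).
Proof.
case=> fm fc [psic psim]; split.
  exact: is_measuring_restrict fc psic.
exact: is_left_module_restrict fm psim.
Qed.

Lemma K_restrict (cl : ClosedStructure C) (P Q A B : C) (f : hom P Q)
    (psi : hom (Q ⊗ A) B) :
  K cl (psi ∘ (f ⊗m idm A)) = K cl psi ∘ f.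
Proof.
by apply: (ihom_ext (cl := cl)); rewrite tens_right_comp -compA !ev_K.
Qed.

Lemma factors_through_precomp (X Y V E : C) (i : hom V E) (g : hom Y E)
    (f : hom X Y) :
  factors_through i g -> factors_through i (g ∘ f).
Proof. by case=> h <-; exists (h ∘ f); rewrite compA. Qed.

End Restriction.

Section RestrictedVAction.
Variables (C : BraidedCategory) (cl : ClosedStructure C).
Variables (Omega : Type) (s t : Omega -> nat) (A : OmegaMagma C s t).
Variable V : Submonoid (end_monoid cl A).

Definition hopf_restriction (X : VAction V) (H : HopfMonoid C)
    (e : @hom (Bimon C) (hopf_bim H) (act_bim X)) : VHopfAction V.
Proof.
refine (@MkVHopfAction C cl Omega s t A V H
          (act_map X ∘ (proj1_sig e ⊗m idm (A : C))) _ _).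
- exact: is_action_restrict (proj2_sig e) (act_action X).
- by rewrite K_restrict; exact: factors_through_precomp (act_factors X).
Defined.

Definition vaction_of_hopf (Y : VHopfAction V) : VAction V :=
  MkVAction (hact_action Y) (hact_factors Y).

Lemma intertwines_restriction (X : VAction V) (H H' : HopfMonoid C)
    (e : @hom (Bimon C) (hopf_bim H) (act_bim X)) (chi : hom (H' ⊗ A) A)
    (f : @hom (Bimon C) (hopf_bim H') (hopf_bim H)) :
  intertwines chi (hact_map (hopf_restriction e)) f <->
  intertwines chi (act_map X) (e ∘ f).
Proof. by rewrite /intertwines /= compA -tens_right_comp. Qed.

End RestrictedVAction.

Theorem theorem4p12 (C : BraidedCategory) (cl : ClosedStructure C)
    (hC : ExtrEpi_Mono_structured C)
    (Omega : Type) (s t : Omega -> nat) (A : OmegaMagma C s t)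
    (V : Submonoid (end_monoid cl A))
    (Hr : Functor (Bimon C) (Hopf C))
    (hHr : Adjunction (forget_antipode C) Hr)
    (hB : universal_acting_bimonoid_exists V) :
  exists X : op (HAct V), is_initial X.
Proof.
case: hB => X hX.
pose e := counit hHr (act_bim X).
exists (@hopf_restriction C cl Omega s t A V X (Hr (act_bim X)) e) => Y.
case: (hX (vaction_of_hopf Y)) => phi [_ phi_uniq].
pose f := transpose hHr (X := hact_hopf Y) (proj1_sig phi).
have ef : e ∘ f = proj1_sig phi by exact: (counit_transpose hHr).
have hf : intertwines (hact_map Y)
            (hact_map (@hopf_restriction _ _ _ _ _ _ _ X (Hr _) e)) f.
  by apply/intertwines_restriction; rewrite ef; exact: (proj2_sig phi).
exists (exist _ f hf); split=> // -[g hg] _; apply: chom_ext => /=.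
have hg' := proj1 (intertwines_restriction _ _ _) hg.
have E := phi_uniq (exist _ (e ∘ g) hg') I.
rewrite /f E /=; exact: (transpose_counit hHr).
Qed.
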